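(* For $i=1,\dots,n$ let $\mathbf a_i=(a_{i,1},\dots,a_{i,r_i})\in\mathbb{F}^{r_i}$ be a $(\sigma,\delta)$-multiplicity sequence, and assume $a_{1,1},\dots,a_{n,1}$ are distinct. Let $a_1,\dots,a_\ell\in\mathbb{F}$ be pairwise non-conjugate, $n_i\in\mathbb{Z}_+$ and $\beta_{i,1},\dots,\beta_{i,n_i}\in\mathbb{F}^*$ be such that $n=n_1+\dots+n_\ell$ and $\{a_{1,1},\dots,a_{n,1}\}=\bigcup_{i=1}^\ell\{a_i^{\beta_{i,1}},\dots,a_i^{\beta_{i,n_i}}\}$. The following are equivalent: (1) $\Omega=\{P_{\mathbf a_1},\dots,P_{\mathbf a_n}\}$ is P-independent; (2) $\Psi=\{a_{1,1},\dots,a_{n,1}\}\subseteq\mathbb{F}$ is P-independent; (3) for each $i=1,\dots,\ell$, the elements $\beta_{i,1},\dots,\beta_{i,n_i}$ are linearly independent over $K^{\sigma,\delta}_{a_i}$ with $\mathbb{F}$ regarded as a right $K^{\sigma,\delta}_{a_i}$-vector space.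
   Context: Let $\mathbb{F}$ be a division ring, $\sigma$ a ring endomorphism and $\delta$ a $\sigma$-derivation; $\mathbb{F}[x;\sigma,\delta]$ is the skew polynomial ring with $xa=\sigma(a)x+\delta(a)$ (domain with right Euclidean division). For $a\in\mathbb{F}$, $F(a)$ is the remainder of right division of $F$ by $x-a$; $a$ is a (right) zero of $F$ if $F(a)=0$. For $\mathbf a=(a_1,\dots,a_r)$, $P_{\mathbf a}=(x-a_r)\cdots(x-a_1)$; $\mathbf a$ is a $(\sigma,\delta)$-multiplicity sequence if $a_1$ is the only right zero of $P_{\mathbf a}$ in $\mathbb{F}$. Conjugation: $a^\beta=\sigma(\beta)a\beta^{-1}+\delta(\beta)\beta^{-1}$ for $\beta\in\mathbb{F}^*$; $a,b$ conjugate if $b=a^\beta$ for some $\beta$. Centralizer: $K^{\sigma,\delta}_a=\{\beta\in\mathbb{F}:\sigma(\beta)a+\delta(\beta)=a\beta\}$, a division subring. For a set $\Omega$ of skew polynomials, $I(\Omega)$ is the left ideal of skew polynomials right-divisible by every element of $\Omega$ and $F_\Omega$ its monic generator of minimal degree (or $0$); $\Omega$ is P-independent if finite, $I(\Omega)\ne\{0\}$ and $\deg F_\Omega=\sum_{P\in\Omega}\deg P$; a finite set $\{b_1,\dots,b_k\}$ of distinct elements of $\mathbb{F}$ is P-independent if $\{x-b_1,\dots,x-b_k\}$ is. *)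

(* Defs.v *)
From HB Require Import structures.
From mathcomp Require Import all_boot all_order all_algebra.
Set Implicit Arguments. Unset Strict Implicit. Unset Printing Implicit Defensive.
Import Order.TTheory GRing.Theory.
Local Open Scope ring_scope.

Section Skew.
Variables (F : unitRingType) (sigma : F -> F) (delta : F -> F).

(* F is a division ring: every nonzero element is invertible (1 != 0 holds in a unitRingType). *)
Definition is_division_ring := forall x : F, x != 0 -> x \is a GRing.unit.

(* delta is a sigma-derivation, convention x a = sigma(a) x + delta(a). *)
Definition is_sigma_derivation :=
  (forall a b, delta (a + b) = delta a + delta b) /\
  (forall a b, delta (a * b) = sigma a * delta b + delta a * b).

(* A skew polynomial sum_i p_i x^i (coefficients on the left) is represented by
   p : {poly F}; only the additive structure of {poly F} is used. *)
Definition xmul (Q : {poly F}) : {poly F} := map_poly sigma Q * 'X + map_poly delta Q.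

Definition smul (P Q : {poly F}) : {poly F} :=
  \sum_(i < size P) P`_i *: iter i xmul Q.

Fixpoint Pseq (s : seq F) : {poly F} :=
  if s is b :: s' then smul (Pseq s') ('X - b%:P) else 1.

(* r is the remainder of the right division of P by x - b, i.e. P(b) = r *)
Definition skrem (P : {poly F}) (b r : F) := exists Q, P = smul Q ('X - b%:P) + r%:P.

Definition rzero (P : {poly F}) (b : F) := skrem P b 0.

Definition mult_seq (s : seq F) :=
  exists a1 s', s = a1 :: s' /\ (forall b, rzero (Pseq s) b <-> b = a1).

Definition rdivides (D G : {poly F}) := exists Q, G = smul Q D.

(* membership in the left ideal I(Omega), Omega given as a finite list (a set up to duplicates) *)
Definition in_I (Om : seq {poly F}) (G : {poly F}) := forall P, P \in Om -> rdivides P G.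

(* P-independence: I(Omega) <> 0 and the minimal degree of a nonzero element of I(Omega)
   (= deg F_Omega) equals the sum of the degrees of the elements of the set Omega. *)
Definition Pindep (Om : seq {poly F}) :=
  exists G, [/\ G != 0, in_I Om G,
    (size G).-1 = (\sum_(P <- undup Om) (size P).-1)%N &
    forall H, H != 0 -> in_I Om H -> (size G <= size H)%N].

Definition Pindep_pts (s : seq F) := uniq s /\ Pindep [seq 'X - b%:P | b <- s].

Definition sconj (a beta : F) := sigma beta * a * beta^-1 + delta beta * beta^-1.

Definition conjugate (a b : F) := exists2 beta, beta != 0 & b = sconj a beta.

Definition in_centralizer (a beta : F) := sigma beta * a + delta beta = a * beta.

Definition right_lin_indep (a : F) (m : nat) (bs : 'I_m -> F) :=
  forall c : 'I_m -> F, (forall k, in_centralizer a (c k)) ->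
    \sum_(k < m) bs k * c k = 0 -> forall k, c k = 0.

End Skew.

(* Main.v *)
Require Import Defs.
From HB Require Import structures.
From mathcomp Require Import all_boot all_order all_algebra.
From mathcomp Require Import zify.
From Stdlib Require Import Classical_Prop Classical_Pred_Type.
Import Order.TTheory GRing.Theory.
Local Open Scope ring_scope.
Set Implicit Arguments. Unset Strict Implicit. Unset Printing Implicit Defensive.

(* Let R be the skew polynomial ring and act on F by P |-> ev a P, where x acts
   as beta |-> sigma(beta) a + delta(beta); then ev a P beta is the value of P at
   the conjugate of a by beta, times beta, and it is right linear over the
   centralizer of a.  By the Ore condition in sharp form (every B <> 0 and V have
   Y <> 0 with deg Y <= deg B and B | Y V), P-independence only says that no
   nonzero common multiple has degree smaller than the sum of the degrees.
   - (1) => (2): a common multiple H of the x - a_j of small degree extends, by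
     the Ore condition, to a common multiple Y H of the P_j of small degree.
   - (2) => (1): R / R P_j has a unique maximal submodule, with quotient
     R / R (x - a_j).  Hence a proper left ideal containing P_k and the common
     multiples of the previous P_j lies in R (x - a_k), and a Nakayama argument
     makes x - a_k divide the common multiples of the previous x - a_j.  So
     these ideals are comaximal and the degrees add up.
   - (2) => (3): by right linearity, a polynomial vanishing at all but one of
     dependent beta's vanishes at the last one if its coefficient is nonzero.
   - (3) => (2): dividing H by x - a^beta sends the remaining beta's to vectors
     that are still independent, as the kernel of the divisor is spanned by
     beta in the class of a and is zero in the other classes. *)

Section SkewRing.
Variables (F : unitRingType) (sigma : {rmorphism F -> F}) (delta : F -> F).
Hypotheses (hF : is_division_ring F) (hdelta : is_sigma_derivation sigma delta).

Local Notation xmul := (xmul sigma delta).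
Local Notation smul := (smul sigma delta).
Local Notation rdivides := (rdivides sigma delta).
Implicit Types P Q R A B C D E G H M U V W Y Z : {poly F}.

(** * Division rings, [sigma] and [delta] *)

Lemma divring_mulf_neq0 (x y : F) : x != 0 -> y != 0 -> x * y != 0.
Proof.
move=> x0 y0; apply: contraNneq x0 => xy0.
by rewrite -(mulrK (hF y0) x) xy0 mul0r.
Qed.

Lemma sigma_eq0 (x : F) : (sigma x == 0) = (x == 0).
Proof.
apply/idP/idP => [|/eqP->]; last by rewrite rmorph0.
apply: contraLR => x0; have := oner_neq0 F.
rewrite -(rmorph1 sigma) -(mulVr (hF x0)) rmorphM.
by apply: contraNneq => ->; rewrite mulr0.
Qed.

Lemma deltaD a b : delta (a + b) = delta a + delta b.
Proof. exact: hdelta.1. Qed.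

Lemma deltaM a b : delta (a * b) = sigma a * delta b + delta a * b.
Proof. exact: hdelta.2. Qed.

Lemma delta0 : delta 0 = 0.
Proof. by apply: (@addrI _ (delta 0)); rewrite -deltaD !addr0. Qed.

Lemma delta1 : delta 1 = 0.
Proof.
apply: (@addrI _ (delta 1)); rewrite addr0.
by have := deltaM 1 1; rewrite !mulr1 rmorph1 mul1r => <-.
Qed.

(** * Pseudo-linear maps and the action of skew polynomials *)

Definition pseudo_linear (M : lmodType F) (T : M -> M) :=
  {morph T : u v / u + v} /\
  forall a u, T (a *: u) = sigma a *: T u + delta a *: u.

(** For pseudo-linear [T] this makes [M] a left module over the skew polynomials, with x acting as
    [T]. The product [smul] is the instance [T := xmul], evaluation the instance [T := twist a]. *)
Definition act (M : lmodType F) (T : M -> M) (P : {poly F}) (m : M) : M :=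
  \sum_(i < size P) P`_i *: iter i T m.

Section Action.
Variables (M : lmodType F) (T : M -> M).

Lemma act_widen n (P : {poly F}) m : (size P <= n)%N ->
  act T P m = \sum_(i < n) P`_i *: iter i T m.
Proof.
move=> le_n; rewrite /act (big_ord_widen n (fun i => P`_i *: iter i T m)) //.
rewrite big_mkcond; apply: eq_bigr => i _.
by case: ltnP => // ?; rewrite nth_default ?scale0r.
Qed.

Lemma actDl P Q m : act T (P + Q) m = act T P m + act T Q m.
Proof.
pose n := maxn (size P) (size Q).
rewrite !(@act_widen n) ?leq_maxl ?leq_maxr ?size_polyD //.
by rewrite -big_split; apply: eq_bigr => i _; rewrite coefD scalerDl.
Qed.

Lemma actZl a P m : act T (a *: P) m = a *: act T P m.
Proof.
rewrite (@act_widen (size P)) ?size_scale_leq // scaler_sumr.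
by apply: eq_bigr => i _; rewrite coefZ scalerA.
Qed.

Lemma act0l m : act T 0 m = 0.
Proof. by rewrite /act size_poly0 big_ord0. Qed.

Lemma actNl P m : act T (- P) m = - act T P m.
Proof. by apply: (@addrI _ (act T P m)); rewrite -actDl !subrr act0l. Qed.

Lemma actBl P Q m : act T (P - Q) m = act T P m - act T Q m.
Proof. by rewrite actDl actNl. Qed.

Lemma act_sum (I : Type) (r : seq I) (G : I -> {poly F}) m :
  act T (\sum_(i <- r) G i) m = \sum_(i <- r) act T (G i) m.
Proof. by elim/big_rec2: _ => [|i x y _ <-]; rewrite ?act0l ?actDl. Qed.

Lemma actXn n m : act T 'X^n m = iter n T m.
Proof.
rewrite /act size_polyXn big_ord_recr /= coefXn eqxx scale1r big1 ?add0r // => i _.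
by rewrite coefXn ltn_eqF ?scale0r // ltn_ord.
Qed.

Lemma actC a m : act T a%:P m = a *: m.
Proof. by rewrite -[a%:P]mulr1 mul_polyC actZl (actXn 0). Qed.

Lemma actX m : act T 'X m = T m.
Proof. by rewrite -['X]expr1 actXn. Qed.

Hypothesis hT : pseudo_linear T.

Lemma pseudo_linear0 : T 0 = 0.
Proof. by rewrite -(scale0r 0) hT.2 rmorph0 delta0 !scale0r addr0. Qed.

Lemma pseudo_linear_sum (I : Type) (r : seq I) (G : I -> M) :
  T (\sum_(i <- r) G i) = \sum_(i <- r) T (G i).
Proof. by elim/big_rec2: _ => [|i x y _ <-]; rewrite ?pseudo_linear0 ?hT.1. Qed.

Lemma actDr P u v : act T P (u + v) = act T P u + act T P v.
Proof.
have itD i : iter i T (u + v) = iter i T u + iter i T v.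
  by elim: i => //= i ->; rewrite hT.1.
by rewrite /act -big_split; apply: eq_bigr => i _; rewrite itD scalerDr.
Qed.

Lemma act0r P : act T P 0 = 0.
Proof. by apply: (@addrI _ (act T P 0)); rewrite -actDr !addr0. Qed.

Lemma actNr P u : act T P (- u) = - act T P u.
Proof. by apply: (@addrI _ (act T P u)); rewrite -actDr !subrr act0r. Qed.

Lemma act_xmul Q m : act T (xmul Q) m = T (act T Q m).
Proof.
have szs : (size (map_poly sigma Q * 'X)%R <= (size Q).+1)%N.
  by rewrite (leq_trans (size_polyMleq _ _)) // size_polyX addn2 ltnS size_poly.
rewrite actDl (act_widen m szs) (@act_widen (size Q) (map_poly delta Q)) ?size_poly //.
rewrite big_ord_recl coefMX scale0r add0r -big_split /act pseudo_linear_sum.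
apply: eq_bigr => i _; rewrite hT.2 coefMX /= coef_map coef_map_id0 ?delta0 //.
Qed.

End Action.

(** * Ring structure of the skew polynomials *)

Lemma coef_xmul Q i :
  (xmul Q)`_i = (if i is j.+1 then sigma Q`_j else 0) + delta Q`_i.
Proof.
rewrite coefD coefMX coef_map [(map_poly delta Q)`_i]coef_map_id0 ?delta0 //.
by case: i.
Qed.

Lemma xmul_pseudo_linear : pseudo_linear xmul.
Proof.
split=> [P Q|a P]; apply/polyP => i; rewrite !(coef_xmul, coefD, coefZ).
  rewrite deltaD addrACA; congr (_ + _).
  by case: i => [|i]; rewrite ?addr0 // coefD rmorphD.
rewrite deltaM mulrDr addrA; congr (_ + _ + _).
by case: i => [|i]; rewrite ?mulr0 // coefZ rmorphM.
Qed.

Lemma smulE P Q : smul P Q = act xmul P Q. Proof. by []. Qed.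

(** For [T := xmul] this is associativity; for [T := twist a] it is the product rule for values. *)
Lemma act_smul (M : lmodType F) (T : M -> M) (hT : pseudo_linear T) P Q m :
  act T (smul P Q) m = act T P (act T Q m).
Proof.
rewrite /Defs.smul act_sum; apply: eq_bigr => i _; rewrite actZl; congr (_ *: _).
by elim: (i : nat) => //= k IH; rewrite act_xmul ?IH.
Qed.

Lemma smulA P Q R : smul P (smul Q R) = smul (smul P Q) R.
Proof. by rewrite 3!smulE -(act_smul xmul_pseudo_linear). Qed.

Lemma smulDl P Q R : smul (P + Q) R = smul P R + smul Q R.
Proof. exact: actDl. Qed.

Lemma smulDr P Q R : smul P (Q + R) = smul P Q + smul P R.
Proof. exact: (actDr xmul_pseudo_linear). Qed.

Lemma smulNl P Q : smul (- P) Q = - smul P Q.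
Proof. exact: actNl. Qed.

Lemma smulNr P Q : smul P (- Q) = - smul P Q.
Proof. exact: (actNr xmul_pseudo_linear). Qed.

Lemma smulBl P Q R : smul (P - Q) R = smul P R - smul Q R.
Proof. by rewrite smulDl smulNl. Qed.

Lemma smul0p P : smul 0 P = 0. Proof. exact: act0l. Qed.

Lemma smulp0 P : smul P 0 = 0. Proof. exact: (act0r xmul_pseudo_linear). Qed.

Lemma smulCp a P : smul a%:P P = a *: P. Proof. exact: actC. Qed.

Lemma smul1p P : smul 1 P = P. Proof. by rewrite smulCp scale1r. Qed.

Lemma smulp1 P : smul P 1 = P.
Proof.
have itX i : iter i xmul 1 = 'X^i.
  elim: i => [|i IH]; rewrite ?expr0 //= IH /Defs.xmul map_polyXn -exprSr.
  rewrite (_ : map_poly delta _ = 0) ?addr0 //; apply/polyP => j.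
  by rewrite coef_map_id0 ?delta0 // coefXn coef0; case: eqP; rewrite ?delta0 ?delta1.
rewrite -[RHS]coefK poly_def; apply: eq_bigr => i _; by rewrite itX.
Qed.

(** * Degrees and right Euclidean division *)

Lemma sigma_inj : injective sigma.
Proof. by move=> x y /eqP; rewrite -subr_eq0 -rmorphB sigma_eq0 subr_eq0 => /eqP. Qed.

Lemma size_xmul Q : Q != 0 -> size (xmul Q) = (size Q).+1.
Proof.
move=> Q0; have sz : size (map_poly sigma Q * 'X) = (size Q).+1.
  rewrite size_mulX ?size_map_inj_poly ?rmorph0 //; first exact: sigma_inj.
  by rewrite -size_poly_eq0 size_map_inj_poly ?rmorph0 ?size_poly_eq0 //; exact: sigma_inj.
by rewrite size_polyDl sz // ltnS size_poly.
Qed.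

Lemma size_iter_xmul k Q : Q != 0 -> size (iter k xmul Q) = (size Q + k)%N.
Proof.
move=> Q0; elim: k => [|k IH]; rewrite ?addn0 //= size_xmul ?IH ?addnS //.
by rewrite -size_poly_eq0 IH addn_eq0 size_poly_eq0 (negPf Q0).
Qed.

Lemma size_scale_divring a (P : {poly F}) : a != 0 -> size (a *: P) = size P.
Proof. by move=> a0; rewrite lreg_size //; apply: mulrI; exact: hF. Qed.

Lemma size_smul P Q : P != 0 -> Q != 0 -> size (smul P Q) = (size P + size Q).-1.
Proof.
move=> P0 Q0; have : lead_coef P != 0 by rewrite lead_coef_eq0.
rewrite /Defs.smul lead_coefE; move: P0; rewrite -size_poly_gt0.
case: (size P) => // d _ /= pd0; rewrite big_ord_recr /= addrC size_polyDl.
  by rewrite size_scale_divring // size_iter_xmul // addnC.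
rewrite size_scale_divring // size_iter_xmul // (leq_ltn_trans (size_sum _ _ _)) //.
have Qgt0 : (0 < size Q)%N by rewrite size_poly_gt0.
rewrite -(prednK Qgt0) addSn ltnS; apply/bigmax_leqP => i _.
rewrite (leq_trans (size_scale_leq _ _)) // size_iter_xmul //.
by rewrite -(prednK Qgt0) addSn -addnS leq_add2l ltn_ord.
Qed.

Lemma smul_neq0 P Q : P != 0 -> Q != 0 -> smul P Q != 0.
Proof.
move=> P0 Q0; rewrite -size_poly_gt0 size_smul // -!subn1 subn_gt0.
move: P0 Q0; rewrite -!size_poly_gt0.
by case: (size P) => // p _; case: (size Q) => // q _; rewrite addnS.
Qed.

Lemma right_euclid B A : B != 0 ->
  exists Q R, A = smul Q B + R /\ (size R < size B)%N.
Proof.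
move=> B0; have [m] := ubnP (size A); elim: m A => // m IH A le_m.
have [ltAB|leBA] := ltnP (size A) (size B).
  by exists 0, A; rewrite smul0p add0r.
have A0 : A != 0 by rewrite -size_poly_gt0 (leq_trans _ leBA) // size_poly_gt0.
(* x^k B has the size of A, and a left scalar then matches the leading coefficients. *)
pose C := iter (size A - size B) xmul B.
have szC : size C = size A by rewrite size_iter_xmul // subnKC.
have C0 : C != 0 by rewrite -size_poly_eq0 szC size_poly_eq0.
pose c := lead_coef A / lead_coef C.
have lt_size : (size (A - c *: C)%R < size A)%N.
  have Agt0 : (0 < size A)%N by rewrite size_poly_gt0.
  rewrite -[X in (_ < X)%N](prednK Agt0) ltnS; apply/leq_sizeP => j le_j.
  rewrite coefB coefZ; have [<-|ne_j] := eqVneq (size A).-1 j.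
    rewrite -{2}szC -!lead_coefE divrK ?subrr //; apply: hF.
    by rewrite lead_coef_eq0.
  have lej : (size A <= j)%N by move: ne_j le_j Agt0; lia.
  by rewrite !nth_default ?szC // mulr0 subrr.
have [|Q [R [eA ltR]]] := IH (A - c *: C); first exact: leq_trans lt_size _.
exists (Q + c *: 'X^(size A - size B)), R; split=> //.
by rewrite smulDl -addrA [_ + R]addrC addrA -eA !smulE actZl actXn subrK.
Qed.

(** * Right divisibility and the Ore condition *)

Lemma rdivides_mull D G H : rdivides D G -> rdivides D (smul H G).
Proof. by move=> [Q ->]; exists (smul H Q); rewrite smulA. Qed.

Lemma rdividesB D G H : rdivides D G -> rdivides D H -> rdivides D (G - H).
Proof. by move=> [Q ->] [R ->]; exists (Q - R); rewrite smulBl. Qed.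

Lemma rdivides_refl D : rdivides D D.
Proof. by exists 1; rewrite smul1p. Qed.

(** Euclidean algorithm on V = Q B + R: a relation Y B = Z R with deg Y <= deg R gives Z V = (Z Q +
    Y) B, and comparing degrees in Y B = Z R gives deg Z <= deg B. *)
Lemma ore_common_multiple B V : B != 0 ->
  exists Y, [/\ Y != 0, (size Y <= size B)%N & rdivides B (smul Y V)].
Proof.
have [m] := ubnP (size B); elim: m B V => // m IH B V ltm B0.
have [Q [R [-> ltR]]] := right_euclid V B0.
have [->|R0] := eqVneq R 0.
  exists 1; rewrite oner_neq0 size_poly1 size_poly_gt0 B0 addr0 smul1p.
  by split=> //; exists Q.
have [|Y [Y0 leY [Z eZ]]] := IH R B _ R0; first exact: leq_trans ltR _.
have Z0 : Z != 0.
  by apply: contraNneq (smul_neq0 Y0 B0) => Z0; rewrite eZ Z0 smul0p.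
exists Z; split=> //.
  have aux y b z r : (0 < z -> 0 < b -> y <= r ->
    (y + b).-1 = (z + r).-1 -> z <= b)%N by lia.
  apply: (aux _ _ _ _ _ _ leY); rewrite ?size_poly_gt0 //.
  by rewrite -!size_smul // eZ.
rewrite smulDr; exists (smul Z Q + Y); by rewrite smulDl smulA -eZ.
Qed.

(** With [D] and [H] equal to 1 this bounds the degree of a common multiple of the P_j; in general
    it extends a common multiple of the right factors D_j to one of the products P_j D_j. *)
Lemma common_left_multiple (J : eqType) (s : seq J) (P D : J -> {poly F}) H :
  (forall j, j \in s -> P j != 0) -> (forall j, j \in s -> rdivides (D j) H) ->
  exists Y, [/\ Y != 0, (size Y <= (\sum_(j <- s) (size (P j)).-1).+1)%N &
    forall j, j \in s -> rdivides (smul (P j) (D j)) (smul Y H)].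
Proof.
elim: s => [|k s IH] P0 HD.
  by exists 1; rewrite oner_neq0 size_poly1 big_nil.
have [j js|j js|Y [Y0 leY HY]] := IH; first by apply: P0; rewrite inE js orbT.
  by apply: HD; rewrite inE js orbT.
have [T eT] := HD k (mem_head _ _).
(* Since H = T D_k, an equality Z Y T = W P_k gives Z Y H = W P_k D_k. *)
have [Z [Z0 leZ [W eW]]] := ore_common_multiple (smul Y T) (P0 k (mem_head _ _)).
exists (smul Z Y); split; first exact: smul_neq0.
  rewrite size_smul // big_cons.
  have aux p y z t : (z <= p -> y <= t.+1 -> (z + y).-1 <= (p.-1 + t).+1)%N by lia.
  exact: aux.
move=> j; rewrite inE => /orP[/eqP->|js]; last by rewrite -smulA; apply/rdivides_mull/HY.
by exists W; rewrite smulA -eW -!smulA -eT.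
Qed.

(** * Evaluation and linear right factors *)

Definition twist (a x : F) : F^o := sigma x * a + delta x.

Lemma twist_pseudo_linear a : @pseudo_linear F^o (twist a).
Proof.
split=> [x y|c x]; rewrite /twist; first by rewrite rmorphD deltaD mulrDl addrACA.
by rewrite /GRing.scale /= deltaM rmorphM mulrDr addrA -mulrA.
Qed.

Definition ev a P (x : F) : F := @act F^o (twist a) P x.

Lemma ev_smul a P Q x : ev a (smul P Q) x = ev a P (ev a Q x).
Proof. exact: act_smul (twist_pseudo_linear a) _ _ _. Qed.

Lemma evDl a P Q x : ev a (P + Q) x = ev a P x + ev a Q x.
Proof. exact: (@actDl F^o (twist a)). Qed.

Lemma evBl a P Q x : ev a (P - Q) x = ev a P x - ev a Q x.
Proof. exact: (@actBl F^o (twist a)). Qed.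

Lemma ev_sum a P (I : Type) (r : seq I) (D : pred I) (G : I -> F) :
  ev a P (\sum_(i <- r | D i) G i) = \sum_(i <- r | D i) ev a P (G i).
Proof.
elim/big_rec2: _ => [|i x y _ <-]; first exact: (act0r (twist_pseudo_linear a)).
exact: (actDr (twist_pseudo_linear a)).
Qed.

Lemma ev0r a P : ev a P 0 = 0.
Proof. exact: (act0r (twist_pseudo_linear a)). Qed.

Lemma evC a c x : ev a c%:P x = c * x. Proof. exact: (@actC F^o (twist a)). Qed.

Lemma ev1 a x : ev a 1 x = x. Proof. by rewrite evC mul1r. Qed.

Lemma ev_XsubC a c x : ev a ('X - c%:P) x = twist a x - c * x.
Proof. by rewrite evBl evC /ev actX. Qed.

Lemma twist_sconj a x : x != 0 -> twist a x = sconj sigma delta a x * x.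
Proof. by move=> x0; rewrite /sconj -mulrDl divrK ?hF. Qed.

Lemma twist1 a : twist a 1 = a * 1.
Proof. by rewrite /twist rmorph1 delta1 mul1r addr0 mulr1. Qed.

Lemma twistMr a x c : in_centralizer sigma delta a c ->
  twist a (x * c) = twist a x * c.
Proof.
rewrite /in_centralizer /twist => hc.
by rewrite rmorphM deltaM addrA -mulrA -mulrDr hc mulrDl mulrA.
Qed.

Lemma evMr a P x c : in_centralizer sigma delta a c ->
  ev a P (x * c) = ev a P x * c.
Proof.
move=> hc; rewrite /ev /act mulr_suml; apply: eq_bigr => i _.
rewrite -[RHS]mulrA; congr (_ * _).
by elim: (i : nat) => //= k ->; rewrite twistMr.
Qed.

Lemma right_divXsubC P c : exists Q r, P = smul Q ('X - c%:P) + r%:P.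
Proof.
have [|Q [R [-> ltR]]] := @right_euclid ('X - c%:P) P.
  by rewrite -size_poly_gt0 size_XsubC.
by exists Q, R`_0; rewrite -size1_polyC // -ltnS; move: ltR; rewrite size_XsubC.
Qed.

(** ['X - c%:P] kills [x], so only the remainder r acts, and r x = 0 forces r = 0. The form
    [twist a x = c * x] covers both the conjugate of [a] by [x] and [a] itself with [x] equal to
    1. *)
Lemma rdivides_XsubC a x c P : x != 0 -> twist a x = c * x ->
  rdivides ('X - c%:P) P <-> ev a P x = 0.
Proof.
move=> x0 e; have ev0 Q : ev a (smul Q ('X - c%:P)) x = 0.
  by rewrite ev_smul ev_XsubC e subrr ev0r.
split=> [[Q ->] //|]; have [Q [r ->]] := right_divXsubC P c.
rewrite evDl ev0 add0r evC => rx0; exists Q.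
have [->|r0] := eqVneq r 0; first by rewrite addr0.
by move: (divring_mulf_neq0 r0 x0); rewrite rx0 eqxx.
Qed.

Lemma rdivides_XsubC1 c P : rdivides ('X - c%:P) P <-> ev c P 1 = 0.
Proof. by apply: rdivides_XsubC; [exact: oner_neq0 | exact: twist1]. Qed.

Lemma rdivides_sconj a x P : x != 0 ->
  rdivides ('X - (sconj sigma delta a x)%:P) P <-> ev a P x = 0.
Proof. by move=> x0; apply: rdivides_XsubC (twist_sconj a x0). Qed.

(** * Left ideals containing a product of linear factors *)

Lemma proper_left_ideal_root (s : seq F) (J : {poly F} -> Prop) :
  (forall P Q, J P -> J Q -> J (P + Q)) -> (forall H P, J P -> J (smul H P)) ->
  J (Pseq sigma delta s) -> ~ J 1 ->
  exists b, forall Q, J Q -> rdivides ('X - b%:P) Q.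
Proof.
elim: s J => [|a s IH] J JD JM JP J1; first by case: J1.
have [allJ|] := classic (forall Q, J Q -> rdivides ('X - a%:P) Q); first by exists a.
move=> /not_all_ex_not[G0 nG0]; have [JG0 ndG0] := imply_to_and _ _ nG0.
have JN Q : J Q -> J (- Q) by move=> JQ; rewrite -[Q]smul1p -smulNl; apply: JM.
(* An element of J with nonzero remainder modulo x - a can be scaled to remainder 1, so J + R (x -
   a) = R. *)
have [G [V [JG eGV]]] : exists G V, J G /\ 1 = G + smul V ('X - a%:P).
  have [Q [r eG0]] := right_divXsubC G0 a.
  have r0 : r != 0.
    by apply: contra_notN ndG0 => /eqP r0; exists Q; rewrite eG0 r0 addr0.
  exists (smul r^-1%:P G0), (- smul r^-1%:P Q); split; first exact: JM.
  rewrite eG0 smulDr smulNl -smulA addrAC subrr add0r smulCp -mul_polyC -polyCM.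
  by rewrite mulVr ?hF.
(* The ideal of all Y with Y (x - a) in J: right multiplication by x - a identifies its quotient
   module with R / J, because J + R (x - a) = R. *)
have [||||b hb] := IH (fun Y => J (smul Y ('X - a%:P))).
- by move=> P Q JP' JQ'; rewrite smulDl; apply: JD.
- by move=> H P JP'; rewrite -smulA; apply: JM.
- exact: JP.
- by rewrite smul1p => Ja; apply: J1; rewrite eGV; apply: JD => //; apply: JM.
(* V represents the class of 1 under this identification: 1 - (x - a) V lies in the new ideal, hence
   vanishes at b, whereas V(b) = 0 would give it the value 1. *)
have Veb : ev b V 1 != 0.
  apply/eqP => Vb.
  have /hb/rdivides_XsubC1 : J (smul (1 - smul ('X - a%:P) V) ('X - a%:P)).
    have -> : smul (1 - smul ('X - a%:P) V) ('X - a%:P) = smul ('X - a%:P) G.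
      rewrite smulBl smul1p -smulA -{1}['X - a%:P]smulp1 {1}eGV smulDr.
      by rewrite addrK.
    exact: JM.
  by rewrite evBl ev_smul Vb ev0r subr0 ev1 => /eqP; rewrite oner_eq0.
(* The value of Q V at b is the value of Q at this conjugate, times V(b); and Q V (x - a) = Q - Q G
   lies in J. *)
exists (sconj sigma delta b (ev b V 1)) => Q JQ.
apply/rdivides_sconj => //; rewrite -ev_smul; apply/rdivides_XsubC1/hb.
have -> : smul (smul Q V) ('X - a%:P) = Q - smul Q G.
  by rewrite -{2}[Q]smulp1 eGV smulDr addrAC subrr add0r smulA.
by apply: JD => //; apply/JN/JM.
Qed.

(** * Comaximality and degrees for factors with a single right root *)

Section LocalFactors.
Variables (J : eqType) (p : J -> seq F) (h : J -> F).
Hypothesis root_p : forall j b,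
  rdivides ('X - b%:P) (Pseq sigma delta (p j)) <-> b = h j.

Local Notation P j := (Pseq sigma delta (p j)).
Local Notation factor_ideal s Q :=
  (forall j, j \in (s : seq J) -> rdivides (P j) Q).
Local Notation point_ideal s Q :=
  (forall j, j \in (s : seq J) -> rdivides ('X - (h j)%:P) Q).

Lemma factor_idealM s H Q : factor_ideal s Q -> factor_ideal s (smul H Q).
Proof. by move=> IQ j js; apply/rdivides_mull/IQ. Qed.

Lemma factor_idealB s Q R :
  factor_ideal s Q -> factor_ideal s R -> factor_ideal s (Q - R).
Proof. by move=> IQ IR j js; apply: rdividesB; [apply: IQ | apply: IR]. Qed.

(** If the left ideal [K] generated by P_k and the factor ideal of [s] is proper, it lies in some R
    (x - b), and its member P_k forces b = [h k]. *)
Lemma comaximal_factor k s :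
  ~ (forall Q, factor_ideal s Q -> rdivides ('X - (h k)%:P) Q) ->
  exists U E, 1 = smul U (P k) + E /\ factor_ideal s E.
Proof.
move=> nQ; apply: NNPP => nUE; apply: nQ => Q IQ.
pose K G := exists U E, G = smul U (P k) + E /\ factor_ideal s E.
have I0 : factor_ideal s 0 by move=> j _; exists 0; rewrite smul0p.
have IN E : factor_ideal s E -> factor_ideal s (- E).
  by move=> IE; rewrite -sub0r; apply: factor_idealB.
have [||||b hb] := @proper_left_ideal_root (p k) K.
- move=> _ _ [U [E [-> IE]]] [V [G [-> IG]]]; exists (U + V), (E + G).
  rewrite smulDl addrACA; split=> //.
  by rewrite -[G]opprK; apply: factor_idealB => //; apply: IN.
- move=> H _ [U [E [-> IE]]]; exists (smul H U), (smul H E).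
  by rewrite smulDr smulA; split=> //; apply: factor_idealM.
- by exists 1, 0; rewrite smul1p addr0.
- exact: nUE.
have <- : b = h k.
  by apply/root_p/hb; exists 1, 0; rewrite smul1p addr0.
by apply: hb; exists 0, Q; rewrite smul0p add0r.
Qed.

Hypothesis indep_h : forall k, exists M,
  (forall j, j != k -> rdivides ('X - (h j)%:P) M) /\
  ~ rdivides ('X - (h k)%:P) M.

(** The radical property of [s] is a hypothesis because [factor_ideal_radical] uses this lemma
    inside its own induction. Taken at [h k] and 1, it would make the separating polynomial M vanish
    at [h k]. *)
Lemma comaximal_of_radical k s : uniq (k :: s) ->
  (forall b x, (forall Q, factor_ideal s Q -> ev b Q x = 0) ->
     forall Y, point_ideal s Y -> ev b Y x = 0) ->
  exists U E, 1 = smul U (P k) + E /\ factor_ideal s E.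
Proof.
move=> /= /andP[ks us] rad; apply: comaximal_factor => all_k.
have [M [Mj []]] := indep_h k.
apply/rdivides_XsubC1/rad; first by move=> Q /all_k/rdivides_XsubC1.
by move=> j js; apply: Mj; apply: contraNneq ks => <-.
Qed.

(* Nakayama's lemma for the cyclic modules R / R P_j, each of which has a
   unique maximal submodule: a functional [ev b _ x] killing the ideal of the
   P_j already kills the ideal of their linear right factors. *)
Lemma factor_ideal_radical s : uniq s -> forall b x,
  (forall Q, factor_ideal s Q -> ev b Q x = 0) ->
  forall Y, point_ideal s Y -> ev b Y x = 0.
Proof.
elim: s => [_ b x kill Y _|k s IH us b x kill Y ZY].
  by rewrite -[x](ev1 b) kill ?ev0r.
have us' : uniq s by case/andP: us.
have [U [E [e1 IE]]] := comaximal_of_radical us (IH us').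
have kill2 Q : factor_ideal s Q -> rdivides (P k) Q -> ev b Q x = 0.
  by move=> IQ PQ; apply: kill => j; rewrite inE => /orP[/eqP->|/IQ].
(* As 1 = U P_k + E, the vector x is the sum of U P_k x and E x. The factor ideal of [s] kills the
   first, since Q U P_k = Q - Q E lies both in that ideal and in R P_k. *)
have eL Q : smul Q (smul U (P k)) = Q - smul Q E.
  by rewrite -{2}[Q]smulp1 e1 smulDr addrK.
rewrite -[Y]smulp1 e1 smulDr evDl !(ev_smul _ Y).
rewrite (IH us' b); first last.
- by move=> j js; apply: ZY; rewrite inE js orbT.
- move=> Q IQ; rewrite -ev_smul; apply: kill2; last first.
    by exists (smul Q U); rewrite smulA.
  by rewrite eL; apply: factor_idealB => //; apply: factor_idealM.
(* P_k kills E x, as P_k E = (1 - P_k U) P_k lies in both ideals. If E x is nonzero, the conjugate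
   of b by it is therefore a root of P_k, that is [h k]. *)
rewrite add0r; have [->|g0] := eqVneq (ev b E x) 0; first exact: ev0r.
apply/rdivides_sconj => //.
suff -> : sconj sigma delta b (ev b E x) = h k by apply: ZY; rewrite mem_head.
apply/root_p/rdivides_sconj => //; rewrite -ev_smul; apply: kill2.
  exact: factor_idealM.
exists (1 - smul (P k) U); rewrite smulBl smul1p -smulA.
by rewrite eL opprB addrC subrK.
Qed.

Lemma comaximal_indep k s : uniq (k :: s) ->
  exists U E, 1 = smul U (P k) + E /\ factor_ideal s E.
Proof.
move=> us; apply: comaximal_of_radical (us) _.
by apply: factor_ideal_radical; case/andP: us.
Qed.

Lemma size_factor_ideal s H : uniq s -> H != 0 -> factor_ideal s H ->
  (\sum_(j <- s) (size (P j)).-1 < size H)%N.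
Proof.
elim: s H => [|k s IH] H us H0 HI; first by rewrite big_nil size_poly_gt0.
have [U [E [e1 IE]]] := comaximal_indep us.
have [A eH] := HI k (mem_head _ _).
have A0 : A != 0 by apply: contraNneq H0 => A0; rewrite eH A0 smul0p.
have P0 : P k != 0 by apply: contraNneq H0 => P0; rewrite eH P0 smulp0.
(* From H = A P_k and Y U = W A follows Y = Y U P_k + Y E = W H + Y E, a nonzero member of the ideal
   of [s] of degree at most deg A = deg H - deg P_k; the induction hypothesis applies to it. *)
have [Y [Y0 leY [W eW]]] := ore_common_multiple U A0.
have IY : factor_ideal s Y.
  have -> : Y = smul W H + smul Y E.
    by rewrite eH smulA -eW -smulA -smulDr -e1 smulp1.
  rewrite -[smul Y E]opprK; apply: factor_idealB.
    by apply: factor_idealM => j js; apply: HI; rewrite inE js orbT.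
  by rewrite -smulNr; apply: factor_idealM; rewrite -[E]smul1p -smulNl; apply: factor_idealM.
rewrite big_cons eH size_smul //.
have /(IH Y)/(_ Y0 IY) : uniq s by case/andP: us.
have aux n y a t : (0 < n -> y <= a -> t < y -> n.-1 + t < (a + n).-1)%N by lia.
by apply: aux => //; rewrite size_poly_gt0.
Qed.

End LocalFactors.

(** * Degree bound from independence in each conjugacy class *)

Lemma size_lin_indep (I : finType) (a b : I -> F) (S : {set I}) H :
  (forall i j x, x != 0 -> twist (a i) x = a j * x -> a i = a j) ->
  (forall c : I -> F, (forall i, in_centralizer sigma delta (a i) (c i)) ->
     (forall u, \sum_(i in S | a i == u) b i * c i = 0) ->
     forall i, i \in S -> c i = 0) ->
  H != 0 -> (forall i, i \in S -> ev (a i) H (b i) = 0) -> (#|S| < size H)%N.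
Proof.
(* Grouping relations by the value [u] of [a] lets one induction on [S] treat all classes
   together. *)
move=> conj_eq; have [m] := ubnP #|S|; elim: m S b H => // m IH S b H ltm indep H0 Hb.
have [S0|[i0 i0S]] := set_0Vmem S; first by rewrite S0 cards0 size_poly_gt0.
have cent0 x : in_centralizer sigma delta x 0.
  by rewrite /in_centralizer rmorph0 delta0 !mul0r mulr0 addr0.
have b0 : b i0 != 0.
  apply/eqP => b0; have := indep (fun i => (i == i0)%:R) _ _ i0 i0S.
  rewrite eqxx => h; have/eqP := oner_neq0 F; apply; apply: h => [i|u].
    by case: eqP => // _; rewrite /in_centralizer -[LHS]/(twist _ _) twist1.
  by apply: big1 => i _; case: eqP => [->|_]; rewrite ?b0 ?mul0r ?mulr0.
pose e := sconj sigma delta (a i0) (b i0).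
have eb : twist (a i0) (b i0) = e * b i0 by exact: twist_sconj.
have [Q eH] : rdivides ('X - e%:P) H by apply/rdivides_sconj => //; exact: Hb.
have Q0 : Q != 0 by apply: contraNneq H0 => Q0; rewrite eH Q0 smul0p.
(* If [w <> 0], then [(b i0)^-1 * w] conjugates [u] to [a i0]. *)
have quot u w : twist u w = e * w ->
    twist u ((b i0)^-1 * w) = a i0 * ((b i0)^-1 * w).
  set d := (b i0)^-1 * w => ew.
  have wd : w = b i0 * d by rewrite /d mulrA mulrV ?mul1r ?hF.
  have : sigma (b i0) * twist u d = sigma (b i0) * (a i0 * d).
    apply: (addIr (delta (b i0) * d)).
    rewrite [in RHS]mulrA -mulrDl -[_ + delta _]/(twist _ _) eb -mulrA -wd -ew.
    by rewrite wd /twist deltaM rmorphM mulrDr addrA mulrA.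
  by apply: mulrI; apply: hF; rewrite sigma_eq0.
have szH : size H = (size Q).+1.
  by rewrite eH size_smul // -?size_poly_gt0 size_XsubC // addn2.
rewrite szH (cardsD1 i0) i0S ltnS.
apply: (IH (S :\ i0) (fun i => ev (a i) ('X - e%:P) (b i))) => //.
- by move: ltm; rewrite (cardsD1 i0) i0S.
- move=> c cK sum0.
  (* The relation among the new vectors says that x - e kills this combination of the old ones. *)
  pose w u := \sum_(i in S :\ i0 | a i == u) b i * c i.
  have ew u : twist u (w u) = e * w u.
    apply/eqP; rewrite -subr_eq0 -ev_XsubC ev_sum; apply/eqP; rewrite -[RHS](sum0 u).
    by apply: eq_bigr => i /andP[_ /eqP <-]; rewrite evMr.
  pose d := (b i0)^-1 * w (a i0).
  have dK : in_centralizer sigma delta (a i0) d by apply: quot.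
  have wbd : w (a i0) = b i0 * d by rewrite /d mulrA mulrV ?mul1r ?hF.
  have dNK : in_centralizer sigma delta (a i0) (- d).
    have := cent0 (a i0); rewrite /in_centralizer -(subrr d) rmorphD deltaD mulrDl.
    by rewrite addrACA mulrDr dK => /addrI.
  have wu u : u != a i0 -> w u = 0.
    have [i /andP[_ /eqP<-] ne|none _] :=
      pickP (fun i => (i \in S :\ i0) && (a i == u)); last by rewrite /w big_pred0.
    apply/eqP; apply: contraNT ne => w0; apply/eqP/(conj_eq _ _ _ _ (quot _ _ (ew _))).
    by rewrite divring_mulf_neq0 // invr_eq0.
  (* [w (a i0) = b i0 * d] becomes a relation over all of [S]; in the other classes [w u] is already
     0. *)
  pose c' i := if i == i0 then - d else c i.
  have := indep c' => h i; rewrite in_setD1 => /andP[ne iS].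
  have := h _ _ i iS; rewrite /c' (negPf ne); apply=> [j|u].
    by case: eqP => [->|].
  have split_sum : \sum_(i in S :\ i0 | a i == u) b i * c' i = w u.
    by apply: eq_bigr => j; rewrite in_setD1 /c' => /andP[/andP[/negPf -> _] _].
  rewrite big_mkcondr (big_setD1 _ i0S) /= -big_mkcondr split_sum /c' eqxx.
  have [<-|ne_u] := eqVneq (a i0) u; first by rewrite wbd mulrN addNr.
  by rewrite wu ?addr0 // eq_sym.
- by move=> i; rewrite in_setD1 => /andP[_ iS]; rewrite -ev_smul -eH Hb.
Qed.

(** * From the definitions of P-independence and multiplicity sequence to degree bounds and roots *)

Lemma vanish_all_but_one (J : finType) (h : J -> F) k :
  exists M, [/\ M != 0, (size M <= #|J|)%N &
    forall j, j != k -> rdivides ('X - (h j)%:P) M].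
Proof.
(* One linear factor per index other than k gives degree at most [#|J|] - 1, too small for M to
   vanish also at k once the points are P-independent. *)
have [||M [M0 leM HM]] := @common_left_multiple J (rem k (enum J))
  (fun j => 'X - (h j)%:P) (fun=> 1) 1.
- by move=> j _; rewrite -size_poly_gt0 size_XsubC.
- by move=> j _; exact: rdivides_refl.
exists M; split=> // [|j jk].
  rewrite (leq_trans leM) //; under eq_bigr do rewrite size_XsubC.
  rewrite sum1_size size_rem ?mem_enum // -cardE prednK //.
  by apply/card_gt0P; exists k.
have := HM j; rewrite !smulp1; apply.
by rewrite mem_rem_uniq ?enum_uniq // inE /= jk mem_enum.
Qed.

Lemma Pindep_size (Om : seq {poly F}) :
  uniq Om -> (forall P, P \in Om -> P != 0) ->
  Pindep sigma delta Om <->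
  forall H, H != 0 -> in_I sigma delta Om H ->
    (\sum_(P <- Om) (size P).-1 < size H)%N.
Proof.
move=> uOm Om0; rewrite /Pindep undup_id //; split=> [[G [G0 _ <- minG]] H H0 HH|bound].
  by rewrite prednK ?size_poly_gt0 //; apply: minG.
(* The Ore upper bound meets the assumed lower bound, so this G has minimal degree. *)
have [|G [G0 leG HG]] := @common_left_multiple _ Om id (fun=> 1) 1 Om0.
  by move=> j _; exact: rdivides_refl.
have IG : in_I sigma delta Om G by move=> P /HG; rewrite !smulp1.
have ltG := bound G G0 IG.
have eG : size G = (\sum_(P <- Om) (size P).-1).+1 by apply/eqP; rewrite eqn_leq leG.
by exists G; split=> // [|H H0 HH]; rewrite eG //; apply: bound.
Qed.

Lemma Pseq_neq0 s : Pseq sigma delta s != 0.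
Proof.
elim: s => [|b s IH] /=; first exact: oner_neq0.
by apply: smul_neq0 => //; rewrite -size_poly_gt0 size_XsubC.
Qed.

Lemma mult_seq_root s b : mult_seq sigma delta s ->
  rdivides ('X - b%:P) (Pseq sigma delta s) <-> b = head 0 s.
Proof.
move=> [a1 [s' [-> root_s]]]; rewrite -[head 0 _]/a1 -root_s /rzero /skrem.
by split=> -[Q ->]; exists Q; rewrite polyC0 addr0.
Qed.

End SkewRing.

(** * Translation of the three conditions and their equivalence *)

Unset Implicit Arguments.

Theorem mainTheorem10 (F : unitRingType) (sigma : {rmorphism F -> F}) (delta : F -> F)
  (hF : is_division_ring F) (hdelta : is_sigma_derivation sigma delta)
  (n : nat) (a : 'I_n -> seq F)
  (ha : forall j, mult_seq sigma delta (a j))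
  (hdist : injective (fun j => head 0 (a j)))
  (l : nat) (al : 'I_l -> F)
  (hal : forall i j, i != j -> ~ conjugate sigma delta (al i) (al j))
  (ns : 'I_l -> nat) (hns : forall i, (0 < ns i)%N)
  (beta : forall i : 'I_l, 'I_(ns i) -> F)
  (hbeta : forall i k, beta i k != 0)
  (hn : n = (\sum_(i < l) ns i)%N)
  (hset : forall x : F, (exists j : 'I_n, x = head 0 (a j)) <->
            (exists (i : 'I_l) (k : 'I_(ns i)), x = sconj sigma delta (al i) (beta i k))) :
  (Pindep sigma delta [seq Pseq sigma delta (a j) | j <- enum 'I_n] <->
   Pindep_pts sigma delta [seq head 0 (a j) | j <- enum 'I_n]) /\
  (Pindep_pts sigma delta [seq head 0 (a j) | j <- enum 'I_n] <->
   (forall i : 'I_l, right_lin_indep sigma delta (al i) (beta i))).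
Proof.
pose h j := head 0 (a j); pose P j := Pseq sigma delta (a j).
have root_P j b : rdivides sigma delta ('X - b%:P) (P j) <-> b = h j.
  exact: mult_seq_root.
have P0 j : P j != 0 by exact: Pseq_neq0.
have X0 (b : F) : 'X - b%:P != 0 by rewrite -size_poly_gt0 size_XsubC.
(* The unique root of P_j recovers [h j], so the list of the P_j has no repetition and its degrees
   are summed over all j. *)
have Pinj : injective P.
  by move=> i j eP; apply: hdist; apply/root_P; rewrite -eP; apply/root_P.
have X_inj : injective (fun b : F => 'X - b%:P).
  by move=> b c /addrI/oppr_inj/polyC_inj.
have h_uniq : uniq [seq h j | j <- enum 'I_n] by rewrite map_inj_uniq ?enum_uniq.
have indepP : Pindep sigma delta [seq P j | j <- enum 'I_n] <->
    forall H : {poly F}, H != 0 -> (forall j, rdivides sigma delta (P j) H) ->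
      (\sum_(j <- enum 'I_n) (size (P j)).-1 < size H)%N.
  have -> := Pindep_size hF hdelta; first last.
  - by move=> _ /mapP[j _ ->].
  - by rewrite map_inj_uniq ?enum_uniq.
  rewrite big_map; split=> bound H H0 HH; apply: bound => //.
    by move=> _ /mapP[j _ ->].
  by move=> j; apply: HH; rewrite map_f ?mem_enum.
have indepX : Pindep_pts sigma delta [seq h j | j <- enum 'I_n] <->
    forall H : {poly F}, H != 0 -> (forall j, rdivides sigma delta ('X - (h j)%:P) H) ->
      (n < size H)%N.
  rewrite /Pindep_pts; have -> := Pindep_size hF hdelta; first last.
  - by move=> _ /mapP[b _ ->].
  - by rewrite map_inj_uniq.
  rewrite 2!big_map big_enum /=; under eq_bigr do rewrite size_XsubC.
  rewrite sum1_card card_ord; split=> [[_ bound]|bound]; last split=> //.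
    move=> H H0 HH; apply: bound => // _ /mapP[_ /mapP[j _ ->] ->]; exact: HH.
  move=> H H0 HH; apply: bound => // j; apply: HH.
  by rewrite (map_f (fun b => 'X - b%:P)) ?map_f ?mem_enum.
(* The pairs (i, k) index the vectors beta; there are n of them, so the bound [n < size H] also
   counts them. *)
pose I := {i : 'I_l & 'I_(ns i)}.
pose B (p : I) := beta (tag p) (tagged p).
have cardI : #|{: I}| = n.
  by rewrite card_tagged sumnE big_map big_enum hn; apply: eq_bigr => i _; rewrite card_ord.
have rootI H : (forall j, rdivides sigma delta ('X - (h j)%:P) H) <->
    forall p : I, ev sigma delta (al (tag p)) H (B p) = 0.
  split=> HH => [p|j].
    apply/(rdivides_sconj hF hdelta) => //; first exact: hbeta.
    have /hset[j ->] : exists i (k : 'I_(ns i)),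
      sconj sigma delta (al (tag p)) (B p) = sconj sigma delta (al i) (beta i k).
      by exists (tag p), (tagged p).
    exact: HH.
  have /hset[i [k eh]] : exists j', h j = head 0 (a j') by exists j.
  rewrite eh; apply/(rdivides_sconj hF hdelta); first exact: hbeta.
  exact: (HH (Tagged (fun i => 'I_(ns i)) k)).
have al_inj i j x : x != 0 -> twist sigma delta (al i) x = al j * x -> i = j.
  move=> x0 ex; apply/eqP; apply: contraT => ij; case: (hal i j ij); exists x => //.
  by apply: (mulIr (hF x x0)); rewrite -(twist_sconj _ _ hF).
split; [rewrite indepP indepX | rewrite indepX]; split.
- move=> bound H H0 HH.
  (* The head of the list is the rightmost factor, so the tail gives the left cofactor of x -
     [h j]. *)
  pose P' j := Pseq sigma delta (behead (a j)).
  have eP j : P j = smul sigma delta (P' j) ('X - (h j)%:P).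
    by rewrite /P /P' /h; case: (ha j) => b [s [-> _]].
  have P'0 j : P' j != 0 by exact: Pseq_neq0.
  have szP j : (size (P j)).-1 = ((size (P' j)).-1 + 1)%N.
    rewrite eP size_smul // size_XsubC.
    by have := P'0 j; rewrite -size_poly_gt0; case: (size _) => // m _; rewrite addn2 addn1.
  (* deg Y is at most the sum of the deg P_j minus n, so (1) applied to Y H forces deg H >= n. *)
  have [//||Y [Y0 leY HY]] := common_left_multiple hF hdelta
    (s := enum 'I_n) (P := P') (D := fun j => 'X - (h j)%:P) (H := H).
    by move=> j _; exact: HH.
  have /bound : smul sigma delta Y H != 0 by exact: smul_neq0.
  rewrite size_smul // => /(_ _)/=.
  under eq_bigr do rewrite szP.
  rewrite big_split /= sum1_size size_enum_ord.
  have aux y t m : (y <= t.+1 -> t + n < (y + m).-1 -> n < m)%N by lia.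
  move=> lt; apply: (aux _ _ _ leY); apply: lt => j.
  by rewrite eP; apply: HY; rewrite mem_enum.
- move=> bound H H0 HH.
  (* Size at most n keeps a nonzero polynomial from vanishing at all n points. *)
  have indep_h k : exists M, (forall j, j != k -> rdivides sigma delta ('X - (h j)%:P) M) /\
      ~ rdivides sigma delta ('X - (h k)%:P) M.
    have [M [M0 leM HM]] := vanish_all_but_one hF hdelta h k.
    exists M; split=> // Mk; move: leM; rewrite card_ord leqNgt bound // => j.
    by have [->|/HM] := eqVneq j k.
  by apply: (size_factor_ideal hF hdelta root_P indep_h (enum_uniq _)) => // j _; exact: HH.
- move=> bound i c cK sum0 k0; apply/eqP; apply: contraT => c0.
  pose p0 : I := Tagged (fun i => 'I_(ns i)) k0.
  have [M [M0 leM HM]] := vanish_all_but_one hF hdelta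
    (fun p : I => sconj sigma delta (al (tag p)) (B p)) p0.
  have evM p : p != p0 -> ev sigma delta (al (tag p)) M (B p) = 0.
    by move=> /HM/(rdivides_sconj hF hdelta); apply; exact: hbeta.
  move: leM; rewrite cardI leqNgt bound //; apply/rootI => p.
  have [->|/evM//] := eqVneq p p0; apply/eqP; rewrite /B /=.
  have : ev sigma delta (al i) M 0 = 0 by exact: ev0r.
  (* M applied to the relation leaves only the term of k0, so M kills that vector too and vanishes
     at all n points. *)
  rewrite -{1}sum0 (ev_sum hdelta) (bigD1 k0) //=.
  rewrite big1 ?addr0 => [|k kk0].
    rewrite (evMr hdelta) // => /eqP; apply: contraLR => ev0.
    exact: divring_mulf_neq0.
  rewrite (evMr hdelta) // (evM (Tagged (fun i => 'I_(ns i)) k)) ?mul0r //.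
  by rewrite eq_Tagged.
- move=> indep H H0 /rootI HH; rewrite -cardI -cardsT.
  apply: (size_lin_indep hF hdelta (a := fun p : I => al (tag p)) (b := B)) => //.
    by move=> p q x x0 /(al_inj _ _ _ x0) ->.
  move=> c cK sum0 [i k] _.
  apply: (indep i (fun k => c (Tagged (fun i => 'I_(ns i)) k))) => [m|]; first exact: cK.
  rewrite -[RHS](sum0 (al i)).
  (* The outer sum reduces to j = i: if [al j] equals [al i], they are conjugate by 1. *)
  transitivity (\sum_(j | al j == al i)
      \sum_(m < ns j) beta j m * c (Tagged (fun i => 'I_(ns i)) m)).
    rewrite (big_pred1 i) // => j; apply/eqP/eqP => [e|-> //].
    by apply: (al_inj j i 1); rewrite ?oner_neq0 // -e; apply: twist1.
  rewrite (sig_big_dep (fun j => al j == al i) (fun _ _ => true)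
    (fun j m => beta j m * c (Tagged (fun i => 'I_(ns i)) m))).
  by apply: eq_big => [p|[j m] _ //]; rewrite inE andbT.
Qed.
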